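(* Assume that the $3$-regular tree quasi-isometrically embeds into some metric space $X$. Let $1<p<\infty$ and $q=\max\{p,2\}$. Then the compression $\rho$ of any uniform embedding of $X$ into any $L^p$-space satisfies $$\int_1^{\infty}\left(\frac{\rho(t)}{t}\right)^q\frac{dt}{t}<\infty.$$
   Context: A map $F:X\to Y$ between metric spaces is a uniform embedding if $d_X(x,y)\to\infty \Longleftrightarrow d_Y(F(x),F(y))\to\infty$ (for sequences of pairs of points). Its compression is $\rho(t)=\inf_{d_X(x,y)\geq t}d_Y(F(x),F(y))$. An $L^p$-space is a Banach space of the form $L^p(X,m)$ with $(X,m)$ a measure space. The $3$-regular tree is infinite, with edges of length $1$. *)

(* Defs.v *)
From HB Require Import structures.
From mathcomp Require Import all_boot all_order all_algebra.
From mathcomp Require Import all_classical all_reals all_analysis.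
Import Order.TTheory GRing.Theory Num.Theory.
Import numFieldNormedType.Exports.

Set Implicit Arguments.
Unset Strict Implicit.
Unset Printing Implicit Defensive.

Local Open Scope classical_set_scope.
Local Open Scope ring_scope.

(* The k-regular tree is unique up to isomorphism, so a statement about it is
   made for an arbitrary vertex type and adjacency relation. *)
Record regular_tree (k : nat) (V : eqType) (adj : rel V) : Prop := RegularTree {
  regular_tree_nonempty : inhabited V ;
  regular_tree_sym : symmetric adj ;
  regular_tree_irr : irreflexive adj ;
  regular_tree_connected :
    forall x y : V, exists2 w : seq V, path adj x w & last x w = y ;
  regular_tree_acyclic :
    forall c : seq V, (2 < size c)%N -> ~ ucycle adj c ;
  regular_tree_degree :
    forall x : V, exists nb : seq V,
      [/\ uniq nb, size nb = k & forall y : V, adj x y = (y \in nb)]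
}.

(* Every edge has length 1.  The metric is put on the vertices only: restricting
   to them a quasi-isometric embedding of the geometric realization gives a
   quasi-isometric embedding of this metric space. *)
Definition path_metric (R : realType) (V : eqType) (adj : rel V) (x y : V) : R :=
  inf [set (size w)%:R | w in [set w : seq V | path adj x w /\ last x w = y]].

(* The distance functions are explicit arguments because the vertices of a tree
   and [LspaceType] carry no [metricType] structure. *)
Definition quasi_isometric_embedding (R : realType) (X Y : Type)
    (dX : X -> X -> R) (dY : Y -> Y -> R) (f : X -> Y) : Prop :=
  exists L C : R, [/\ 1 <= L, 0 <= C &
    forall x y : X, L^-1 * dX x y - C <= dY (f x) (f y) <= L * dX x y + C].

Definition quasi_isometrically_embeds (R : realType) (X Y : Type)
    (dX : X -> X -> R) (dY : Y -> Y -> R) : Prop :=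
  exists f : X -> Y, quasi_isometric_embedding dX dY f.

Definition uniform_embedding (R : realType) (X Y : Type)
    (dX : X -> X -> R) (dY : Y -> Y -> R) (F : X -> Y) : Prop :=
  forall x y : nat -> X,
    (dX (x n) (y n) @[n --> \oo] --> +oo) <->
    (dY (F (x n)) (F (y n)) @[n --> \oo] --> +oo).

(* Extended-real valued, so that the infimum of the empty set is +oo. *)
Definition compression (R : realType) (X Y : Type)
    (dX : X -> X -> R) (dY : Y -> Y -> R) (F : X -> Y) (t : R) : \bar R :=
  ereal_inf [set (dY (F z.1) (F z.2))%:E | z in [set z : X * X | t <= dX z.1 z.2]].

Lemma lt1_lee1 (R : realType) (p : R) : 1 < p -> (1 <= p%:E)%E.
Proof. by move=> /ltW; rewrite lee_fin. Qed.

(* [LspaceType] has no norm in the library; [fine] is harmless, the p-norm of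
   a difference of two elements being finite. *)
Definition Lp_dist (d : measure_display) (T : measurableType d) (R : realType)
    (mu : {measure set T -> \bar R}) (p : R) (p1 : (1 <= p%:E)%E)
    (f g : LspaceType mu p1) : R :=
  fine ('N[mu]_(p%:E)[(fun x => (f x - g x)%:E)])%E.

(* Main.v *)
(* An L^p-space satisfies a fork inequality: if x0, x1, y and x0, x1, z are two
   paths with steps of length at most l, and q = max(p, 2), then one of |x0 - y|^q
   and |x0 - z|^q is at most (2 l)^q - c |y - z|^q.  This follows from q-uniform
   convexity, |a + b|^q + c |a - b|^q <= 2^(q-1) (|a|^q + |b|^q), which for p >= 2
   is obtained by integrating a pointwise inequality, and for p < 2 by integrating
   a pointwise two-point inequality and using reverse Minkowski in L^(p/2).

   In the 3-regular tree a geodesic of length 2^n can be continued in two ways to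
   geodesics of length 2^(n+1), whose tips are at distance 2^(n+1).  Choosing the
   better continuation at every scale, the normalised length |f v - f w|^q / 2^(nq)
   decreases at step n by at least a constant times (rho(2^n) / 2^n)^q, and it
   starts from the Lipschitz constant of the map on edges.  Hence the dyadic sum of
   (rho(2^n) / 2^n)^q, which dominates the integral, is finite. *)

Require Import Defs.
From mathcomp Require Import all_boot all_order all_algebra.
From mathcomp Require Import all_classical all_reals all_analysis.
From mathcomp Require Import measurable_realfun ring lra zify.
Import Order.TTheory GRing.Theory Num.Theory.
Import numFieldNormedType.Exports.

Set Implicit Arguments.
Unset Strict Implicit.
Unset Printing Implicit Defensive.

Local Open Scope classical_set_scope.
Local Open Scope ring_scope.

(** * Nonbacktracking walks and the path metric of a tree *)

(** For walks from a common vertex, this is what prevents a turn-back at that vertex when one walk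
    is reversed and the other then followed. *)
Definition branching (V : eqType) (p q : seq V) :=
  if p is y :: _ then if q is z :: _ then y != z else true else true.

Fixpoint nonbacktracking (V : eqType) (s : seq V) :=
  if s is x :: s' then branching [:: x] (behead s') && nonbacktracking s'
  else true.

(** The condition concerns triples of consecutive vertices, and each triple of the glued walk lies
    in one of the two pieces or consists of [t], [u] and the head of [q]. *)
Lemma nonbacktracking_cat (V : eqType) (s q : seq V) (t u : V) :
  nonbacktracking (s ++ [:: t; u]) -> nonbacktracking (u :: q) ->
  branching [:: t] q -> nonbacktracking (s ++ t :: u :: q).
Proof.
move=> + nq bq; elim: s => [|a [|b s] IH] /=.
- by case: q bq nq => //= z q -> ->.
- by move=> /andP[-> /IH].
- by case: s IH => [|? ?] IH /= /andP[-> /IH].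
Qed.

Section Walks.
Variables (V : eqType) (adj : rel V).

Hypothesis adj_sym : symmetric adj.

Lemma nonbacktracking_catrev (x : V) (p q : seq V) :
  nonbacktracking (x :: p) -> nonbacktracking (x :: q) -> branching p q ->
  nonbacktracking (catrev p (x :: q)).
Proof.
elim: p x q => [//|y p IH] x q /= /andP[xp yp] xq yq.
apply: IH => //=; first by move: yq xq; case: q => //= z q -> ->.
by case: p xp {yp} => //= z p; rewrite eq_sym.
Qed.

Lemma sorted_catrev (x : V) (p q : seq V) :
  path adj x p -> path adj x q -> sorted adj (catrev p (x :: q)).
Proof.
elim: p x q => [//|y p IH] x q /= /andP[xy yp] xq.
by apply: IH => //=; rewrite adj_sym xy.
Qed.

Lemma nonbacktracking_reduction (x : V) (w : seq V) : path adj x w ->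
  exists p, [/\ path adj x p, nonbacktracking (x :: p), last x p = last x w
              & (size p <= size w)%N].
Proof.
elim: w x => [|y w IH] x /=; first by exists [::].
move=> /andP[xy /IH[p [yp np lp sp]]].
case: p yp np lp sp => [|z p] /= yp np lp sp; first by exists [:: y]; rewrite /= xy.
(* If the walk returns to [x] at once, these two steps cancel. *)
have [xz|xz] := eqVneq x z.
  move: yp np lp; rewrite -xz => /andP[_ xp] /andP[_ np] lp.
  by exists p; split=> //; lia.
by exists (y :: z :: p); rewrite /= xy yp xz.
Qed.

Hypothesis adj_irr : irreflexive adj.
Hypothesis adj_acyclic : forall c : seq V, (2 < size c)%N -> ~ ucycle adj c.

(** A return to [x] closes a cycle: length one contradicts irreflexivity, length two the absence of
    backtracking, and greater length acyclicity. *)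
Lemma nonbacktracking_uniq (x : V) (p : seq V) :
  path adj x p -> nonbacktracking (x :: p) -> uniq (x :: p).
Proof.
elim: p x => [//|y p IH] x xyp nxyp.
have uyp : uniq (y :: p).
  by move: xyp nxyp => /= /andP[_ yp] /andP[_]; exact: IH.
rewrite /= -/(uniq (y :: p)) uyp andbT; apply/negP => xp.
move: xyp nxyp uyp.
case/splitPr: xp => p1 p2; rewrite cat_path /= => /and3P[xp1 lx _] nb.
rewrite cat_uniq /= => /and3P[up1 /norP[xp1' _] _].
have cyc : ucycle adj (x :: p1).
  by rewrite /ucycle /= rcons_path xp1 lx xp1' up1.
case: p1 => [|a [|b p1]] in xp1 lx nb up1 xp1' cyc *.
- by move: lx; rewrite /= adj_irr.
- by move: nb; rewrite /= eqxx.
- exact: (adj_acyclic _ cyc).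
Qed.

(** Reversing [p] and then following [q] gives a nonbacktracking walk, which repeats no vertex. *)
Lemma branching_last_neq (x : V) (p q : seq V) :
  path adj x p -> nonbacktracking (x :: p) ->
  path adj x q -> nonbacktracking (x :: q) ->
  branching p q -> p != [::] -> last x p <> last x q.
Proof.
move=> xp np xq nq b p0 e.
have S := sorted_catrev xp xq; have N := nonbacktracking_catrev np nq b.
have : uniq (catrev p (x :: q)).
  by case: (catrev _ _) S N => // y s; exact: nonbacktracking_uniq.
rewrite catrevE cat_uniq => /and3P[_ /hasPn /(_ (last x q) (mem_last _ _))].
rewrite mem_rev -e => /negP + _; apply.
by case: p p0 {e b np xp S N} => //= y p _; exact: mem_last.
Qed.

Lemma nonbacktracking_unique (x : V) (p q : seq V) :
  path adj x p -> nonbacktracking (x :: p) ->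
  path adj x q -> nonbacktracking (x :: q) -> last x p = last x q -> p = q.
Proof.
elim: p x q => [|y p IH] x [|z q] xp np xq nq e //.
- by have /esym := e; case/(branching_last_neq xq nq xp np).
- by case/(branching_last_neq xp np xq nq): e.
have [yz|yz] := eqVneq y z.
  move: xp xq np nq e; rewrite -yz.
  move=> /andP[_ yp] /andP[_ yq] /andP[_ np] /andP[_ nq] e.
  by rewrite (IH y q).
by case: (branching_last_neq xp np xq nq _ _ e).
Qed.

(** Every competing walk reduces to a nonbacktracking one that is no longer, and uniqueness
    identifies the latter with [p]. *)
Lemma path_metric_nonbacktracking (R : realType) (x : V) (p : seq V) :
  path adj x p -> nonbacktracking (x :: p) ->
  path_metric R adj x (last x p) = (size p)%:R.
Proof.
move=> xp np; rewrite /path_metric; apply/eqP; rewrite eq_le; apply/andP; split.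
  apply: ge_inf; last by exists p.
  by exists 0 => _ [w _ <-]; exact: ler0n.
apply: lb_le_inf; first by exists (size p)%:R, p.
move=> _ [w [xw e] <-]; rewrite ler_nat.
have [p' [xp' np' e' sp']] := nonbacktracking_reduction xw.
by rewrite (nonbacktracking_unique xp np xp' np') // e' e.
Qed.

Lemma path_metric_branching (R : realType) (x : V) (p q : seq V) :
  path adj x p -> nonbacktracking (x :: p) ->
  path adj x q -> nonbacktracking (x :: q) -> branching p q ->
  path_metric R adj (last x p) (last x q) = (size p + size q)%:R.
Proof.
move=> xp np xq nq b.
have := sorted_catrev xp xq; have := nonbacktracking_catrev np nq b.
have -> : catrev p (x :: q) = last x p :: rev (belast x p) ++ q.
  by rewrite -[LHS]/(catrev (x :: p) q) catrevE lastI rev_rcons.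
move=> N S; have := path_metric_nonbacktracking R S N.
rewrite size_cat size_rev size_belast => <-; congr path_metric.
rewrite last_cat; case: q {xq nq b N S} => //.
by case: p {xp np} => //= y p; rewrite rev_cons last_rcons.
Qed.

Lemma path_metric_adj (R : realType) (x y : V) : adj x y ->
  path_metric R adj x y = 1.
Proof.
by move=> xy; apply: (@path_metric_nonbacktracking R x [:: y]); rewrite /= ?xy.
Qed.

(** * Iterating a fork inequality along dyadic geodesics *)

Hypothesis adj_forks : forall t u : V, exists y z : V,
  [/\ adj u y, adj u z, y != t, z != t & y != z].

(* [E] plays the role of the q-th power of a distance and [K] that of 2^q.  By
   induction on [n], every edge extends to a geodesic of length 2^n whose E-length
   is at most K^n times [M - c * sum]: continue the geodesic of length 2^n in two
   ways and keep the continuation selected by the fork inequality. *)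
Lemma fork_sum_le (R : realType) (E : V -> V -> R) (K c M : R) (e : nat -> R) :
  0 < K -> 0 < c -> (forall x y, 0 <= E x y) ->
  (forall x y, adj x y -> E x y <= M) ->
  (forall n x y, path_metric R adj x y = (2 * 2 ^ n)%:R -> e n <= E x y) ->
  (forall x0 x1 y z B, E x0 x1 <= B -> E x1 y <= B -> E x1 z <= B ->
    E x0 y <= K * B - c * E y z \/ E x0 z <= K * B - c * E y z) ->
  (exists x y, adj x y) ->
  forall n, \sum_(k < n) e k / K ^+ k.+1 <= M / c.
Proof.
move=> K0 c0 E0 EM eE fork [x0 [y0 xy0]] n.
(* All edges are covered at once, because the induction hypothesis is needed for the initial edge
   and for both edges that leave the tip. *)
suff main : forall n v w, adj v w -> exists p : seq V,
    [/\ path adj v (w :: p), nonbacktracking [:: v, w & p],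
        size (w :: p) = (2 ^ n)%N &
        E v (last w p) <= K ^+ n * (M - c * \sum_(k < n) e k / K ^+ k.+1)].
  (* Nonnegativity of [E] forces the bracket to be nonnegative, which bounds the sum. *)
  have [p [_ _ _]] := main n _ _ xy0; move=> /(le_trans (E0 _ _)).
  by rewrite pmulr_rge0 ?exprn_gt0 // subr_ge0 ler_pdivlMr // mulrC.
move=> {}n; elim: n => [|n IH] v w vw.
  by exists [::]; rewrite /= vw big_ord0 expr0 mul1r mulr0 subr0 EM.
have [p [vp np sp Ep]] := IH _ _ vw.
set u := last w p in Ep *.
(* Here [t] precedes the tip [u]; it is the vertex that both continuations must avoid. *)
have [s [t st]] : exists s t, [:: v, w & p] = s ++ [:: t; u].
  exists (belast v (belast w p)), (last v (belast w p)).
  by rewrite -cat_rcons -lastI cats1 /= -lastI.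
have [y [z [uy uz yt zt yz]]] := adj_forks t u.
have [py [uyp nyp syp Ey]] := IH _ _ uy.
have [pz [uzp nzp szp Ez]] := IH _ _ uz.
have dist : path_metric R adj (last y py) (last z pz) = (2 * 2 ^ n)%:R.
  rewrite (@path_metric_branching R u (y :: py) (z :: pz)) //.
  by rewrite syp szp addnn mul2n.
have bound : E (last y py) (last z pz) >= e n by exact: eE.
have extend a q : path adj u (a :: q) -> nonbacktracking [:: u, a & q] ->
    size (a :: q) = (2 ^ n)%N -> a != t ->
    E v (last a q) <=
      K * (K ^+ n * (M - c * \sum_(k < n) e k / K ^+ k.+1)) -
      c * E (last y py) (last z pz) ->
    exists r : seq V,
    [/\ path adj v (w :: r), nonbacktracking [:: v, w & r],
        size (w :: r) = (2 ^ n.+1)%N &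
        E v (last w r) <= K ^+ n.+1 * (M - c * \sum_(k < n.+1) e k / K ^+ k.+1)].
  move=> ua na sa ta le; exists (p ++ a :: q); split.
  - by rewrite -cat_cons cat_path vp.
  - have -> : [:: v, w & p ++ a :: q] = s ++ [:: t, u, a & q].
      by rewrite -[LHS]/([:: v, w & p] ++ a :: q) st -catA.
    by apply: nonbacktracking_cat => //=; rewrite -?st // eq_sym.
  - by rewrite -cat_cons size_cat sp sa addnn expnS mul2n.
  - rewrite last_cat /=; apply: le_trans le _.
    rewrite big_ord_recr /=.
    rewrite [leRHS](_ : _ = K * (K ^+ n * (M - c * \sum_(k < n) e k / K ^+ k.+1))
       - c * e n); first by rewrite lerD2l lerN2 ler_pM2l.
    by rewrite exprS; field; rewrite ?expf_neq0 ?gt_eqF.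
by case: (fork _ _ _ _ _ Ep Ey Ez); apply: extend.
Qed.

End Walks.

(** Deleting [t] from three neighbours leaves at least two; [t] may be any vertex, adjacent to [u]
    or not. *)
Lemma regular_tree_forks (V : eqType) (adj : rel V) (t u : V) :
  regular_tree 3 adj ->
  exists y z : V, [/\ adj u y, adj u z, y != t, z != t & y != z].
Proof.
move=> /regular_tree_degree /(_ u)[nb [un sn Hn]].
have : (1 < size (rem t nb))%N.
  by have [tn|tn] := boolP (t \in nb); [rewrite size_rem | rewrite rem_id]; rewrite ?sn.
case E : (rem t nb) => [|y [|z s]] // _.
have H a : a \in rem t nb -> adj u a /\ a != t.
  by rewrite mem_rem_uniq // !inE Hn => /andP[-> ->].
have := rem_uniq t un; rewrite E /= inE => /andP[/norP[yz _] _].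
have [|uy yt] := H y; first by rewrite E mem_head.
have [|uz zt] := H z; first by rewrite E !inE eqxx orbT.
by exists y, z; split.
Qed.

(** * Convexity inequalities for real powers *)

Section PowerInequalities.
Variable R : realType.
Implicit Types (p r x y u v s t a b : R).

(** Young's inequality for the numbers [x] and 1, with exponents [p] and [p / (p - 1)]. *)
Lemma bernoulli_powR p x : 1 <= p -> 0 <= x -> 1 + p * (x - 1) <= x `^ p.
Proof.
rewrite le_eqVlt => /predU1P[<-|p1] x0; first by rewrite powRr1 //; lra.
have p0 : 0 < p by lra.
have := @conjugate_powR R x 1 p (p / (p - 1)) x0 ler01 p0.
rewrite powR1 mulr1 invf_div => /(_ _ _)/wrap[||h].
- by rewrite divr_gt0 // subr_gt0.
- by field; rewrite gt_eqF.
have : p * x <= p * (x `^ p / p + 1 * ((p - 1) / p)) by rewrite ler_pM2l.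
rewrite [leRHS](_ : _ = x `^ p + p - 1); first by lra.
by field; rewrite gt_eqF.
Qed.

Lemma tangent_powR p x y : 1 <= p -> 0 <= x -> 0 < y ->
  y `^ p + p * y `^ (p - 1) * (x - y) <= x `^ p.
Proof.
move=> p1 x0 y0; have p0 : 0 < p by lra.
have := bernoulli_powR p1 (divr_ge0 x0 (ltW y0)).
rewrite -(ler_pM2l (powR_gt0 p y0)). rewrite -powRM ?divr_ge0 ?(ltW y0) //.
rewrite (_ : y * (x / y) = x); last by rewrite mulrCA mulfV ?mulr1 ?gt_eqF.
apply: le_trans.
rewrite -(mulr_powRB1 (ltW y0) p0) le_eqVlt; apply/orP; left; apply/eqP.
by field; rewrite gt_eqF.
Qed.

(** The tangent inequalities at the mean [m], weighted by [a] and [b], add up to the claim because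
    their linear terms cancel. *)
Lemma convex_combination_powR p a b x y : 1 <= p -> 0 <= a -> 0 <= b ->
  a + b = 1 -> 0 <= x -> 0 <= y ->
  (a * x + b * y) `^ p <= a * x `^ p + b * y `^ p.
Proof.
move=> p1 a0 b0 ab x0 y0; set m := a * x + b * y.
have : 0 <= m by rewrite addr_ge0 ?mulr_ge0.
rewrite le_eqVlt => /predU1P[<-|m0].
  by rewrite powR0 ?addr_ge0 ?mulr_ge0 ?powR_ge0 // gt_eqF; lra.
have hx := ler_wpM2l a0 (tangent_powR p1 x0 m0).
have hy := ler_wpM2l b0 (tangent_powR p1 y0 m0).
apply: le_trans (lerD hx hy).
have -> : b = 1 - a by lra.
rewrite le_eqVlt; apply/orP; left; apply/eqP.
have e : m = a * x + (1 - a) * y by rewrite /m; congr (_ + _ * _); lra.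
transitivity (m `^ p + p * m `^ (p - 1) * (a * x + (1 - a) * y - m)); last by ring.
by rewrite -e; ring.
Qed.

(** Convexity for the exponent [r^-1], applied to the r-th powers of [x] and [y]. *)
Lemma concave_combination_powR r a b x y : 0 < r -> r <= 1 -> 0 <= a -> 0 <= b ->
  a + b = 1 -> 0 <= x -> 0 <= y ->
  a * x `^ r + b * y `^ r <= (a * x + b * y) `^ r.
Proof.
move=> r0 r1 a0 b0 ab x0 y0.
have rV : 1 <= r^-1 by rewrite -invr1 lef_pV2 ?posrE.
have := convex_combination_powR rV a0 b0 ab (powR_ge0 x r) (powR_ge0 y r).
rewrite -!powRrM mulfV ?gt_eqF // !powRr1 // => h.
have := @ge0_ler_powR _ r (ltW r0) _ _ _ _ h.
rewrite -powRrM mulVf ?gt_eqF // powRr1; last by rewrite addr_ge0 ?mulr_ge0 ?powR_ge0.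
by apply; rewrite nnegrE ?powR_ge0 ?addr_ge0 ?mulr_ge0.
Qed.

Lemma bernoulli_powR_le r x : 0 < r -> r <= 1 -> 0 <= x ->
  x `^ r <= 1 + r * (x - 1).
Proof.
move=> r0 r1 x0.
have rV : 1 <= r^-1 by rewrite -invr1 lef_pV2 ?posrE.
have := bernoulli_powR rV (powR_ge0 x r).
rewrite -powRrM mulfV ?gt_eqF // powRr1 // -(ler_pM2l r0).
rewrite mulrDr mulrA mulfV ?gt_eqF //; lra.
Qed.

Lemma sqr_powR_half x r : 0 <= x -> (x ^+ 2) `^ (r / 2) = x `^ r.
Proof.
by move=> x0; rewrite -powR_mulrn // -powRrM mulrC divfK.
Qed.

(** With s = x + y, each z in [0, s] satisfies z^r <= (z / s) s^r, since z / s <= 1 and r >= 1; the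
    cases z = x and z = y are added. *)
Lemma powR_superadditive r x y : 1 <= r -> 0 <= x -> 0 <= y ->
  x `^ r + y `^ r <= (x + y) `^ r.
Proof.
move=> r1; have r0 : 0 < r by lra.
rewrite le_eqVlt => /predU1P[<- y0|x0 y0]; first by rewrite powR0 ?gt_eqF ?add0r.
have s0 : 0 < x + y by lra.
have H z : 0 <= z -> z <= x + y -> z `^ r <= z / (x + y) * (x + y) `^ r.
  rewrite le_eqVlt => /predU1P[<- _|z0 zs]; first by rewrite powR0 ?mul0r ?gt_eqF.
  rewrite -{1}(divfK (lt0r_neq0 s0) z) powRM ?divr_ge0 ?(ltW z0) ?(ltW s0) //.
  rewrite ler_wpM2r ?powR_ge0 // ge1r_powR // divr_gt0 //=.
  by rewrite ler_pdivrMr // mul1r.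
apply: le_trans (lerD (H x _ _) (H y _ _)) _; try lra.
by rewrite -mulrDl -mulrDl mulfV ?mul1r ?gt_eqF.
Qed.

(** In terms of squares: superadditivity for the exponent [p / 2], then the parallelogram identity,
    then convexity. *)
Lemma clarkson_pointwise p u v : 2 <= p ->
  `|u| `^ p + `|v| `^ p <= (`|u + v| `^ p + `|u - v| `^ p) / 2.
Proof.
move=> p2; have r1 : 1 <= p / 2 by lra.
rewrite -!(sqr_powR_half _ (normr_ge0 _)) !real_normK ?num_real //.
apply: le_trans (powR_superadditive r1 (sqr_ge0 u) (sqr_ge0 v)) _.
have h : (0 : R) <= 2^-1 by rewrite invr_ge0.
have := convex_combination_powR r1 h h _ (sqr_ge0 (u + v)) (sqr_ge0 (u - v)).
have -> : 2^-1 * (u + v) ^+ 2 + 2^-1 * (u - v) ^+ 2 = u ^+ 2 + v ^+ 2 by field.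
by move=> H; rewrite [leRHS]mulrC mulrDr; apply: H; lra.
Qed.

(** A quarter of the slope of the chord of x^(p-1) over [1, 2]; it measures the quadratic gain for
    exponents below 2. *)
Definition two_point_const p : R := (2 `^ (p - 1) - 1) / 4.

Lemma two_point_const_gt0 p : 1 < p -> 0 < two_point_const p.
Proof.
move=> p1; rewrite divr_gt0 // subr_gt0.
have r0 : 0 < p - 1 by lra.
have := @gt0_ltr_powR R _ r0 1 2; rewrite !nnegrE powR1.
by apply; lra.
Qed.

Lemma two_point_const_le1 p : p <= 2 -> two_point_const p <= 1.
Proof.
move=> p2; rewrite ler_pdivrMr //.
have : (2 : R) `^ (p - 1) <= 2 by apply: ler1_powR; lra.
by lra.
Qed.

(* The tangent inequality is used at [1] and at [1 + v / 2]: the slope increases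
   between these two points, which gives the quadratic gain. *)
Lemma powR_1D_ge p v : 1 < p -> p <= 2 -> 0 <= v -> v <= 1 ->
  1 + p * v + p * two_point_const p * v ^+ 2 <= (1 + v) `^ p.
Proof.
move=> p1 p2 v0 v1; set m := 1 + v / 2.
have m0 : 0 < m by rewrite /m; lra.
have v10 : 0 <= 1 + v by lra.
have h1 := tangent_powR (ltW p1) v10 m0.
have h2 := bernoulli_powR (ltW p1) (ltW m0).
(* Chord bound for the concave power [p - 1]: [m] combines 1 and 2 with weights [1 - v / 2] and
   [v / 2]. *)
have h3 : 1 + (2 `^ (p - 1) - 1) * (v / 2) <= m `^ (p - 1).
  have := @concave_combination_powR (p - 1) (1 - v / 2) (v / 2) 1 2.
  rewrite powR1 mulr1 (_ : 1 - v / 2 + v / 2 * 2 = m); last by rewrite /m; field.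
  move=> H; apply: le_trans (H _ _ _ _ _ _ _) => //; lra.
have h4 : 0 <= p * (v / 2) by rewrite mulr_ge0; lra.
have h5 := ler_wpM2l h4 h3.
apply: le_trans h1.
rewrite (_ : 1 + v - m = v / 2); last by rewrite /m; field.
rewrite (_ : p * m `^ (p - 1) * (v / 2) = p * (v / 2) * m `^ (p - 1)); last by ring.
apply: le_trans (lerD h2 h5).
by rewrite le_eqVlt; apply/orP; left; apply/eqP; rewrite /m /two_point_const; field.
Qed.

(** Homogeneity reduces to [u = 1] and s = v / u. Bernoulli bounds the left side from above, and the
    lower bounds for 1 + s and 1 - s add up with cancelling linear terms. *)
Lemma two_point_ordered p u v : 1 < p -> p <= 2 -> 0 <= v -> v <= u ->
  (u ^+ 2 + two_point_const p * v ^+ 2) `^ (p / 2) <=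
  ((u + v) `^ p + (u - v) `^ p) / 2.
Proof.
move=> p1 p2 v0 vu; have : 0 <= u by lra.
have c0 := two_point_const_gt0 p1.
rewrite le_eqVlt => /predU1P[u0|u0].
  have -> : v = 0 by lra.
  rewrite -u0 expr0n mulr0 addr0 powR0; last by apply/lt0r_neq0; lra.
  by rewrite divr_ge0 ?addr_ge0 ?powR_ge0.
set s := v / u.
have s0 : 0 <= s by rewrite divr_ge0 // ltW.
have s1 : s <= 1 by rewrite ler_pdivrMr // mul1r.
have -> : v = u * s by rewrite /s mulrCA mulfV ?mulr1 ?gt_eqF.
have -> : u ^+ 2 + two_point_const p * (u * s) ^+ 2 =
    u ^+ 2 * (1 + two_point_const p * s ^+ 2) by ring.
have -> : u + u * s = u * (1 + s) by ring.
have -> : u - u * s = u * (1 - s) by ring.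
have t0 : 0 <= 1 + two_point_const p * s ^+ 2.
  by rewrite addr_ge0 // mulr_ge0 ?sqr_ge0 // ltW.
have s'0 : 0 <= 1 - s by lra.
have s''0 : 0 <= 1 + s by lra.
rewrite (powRM _ (sqr_ge0 u) t0) (powRM _ (ltW u0) s'0) (powRM _ (ltW u0) s''0).
rewrite (sqr_powR_half _ (ltW u0)) -mulrDr -mulrA ler_pM2l ?powR_gt0 //.
have r0 : 0 < p / 2 by lra.
have r1 : p / 2 <= 1 by lra.
apply: le_trans (bernoulli_powR_le r0 r1 t0) _.
have h1 := powR_1D_ge p1 p2 s0 s1.
have h2 := bernoulli_powR (ltW p1) s'0.
have := lerD h1 h2; set A := _ `^ p; set B := _ `^ p; set c := two_point_const p.
rewrite (_ : _ + _ = 2 + p * c * s ^+ 2); last by ring.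
rewrite (_ : 1 + p / 2 * _ = (2 + p * c * s ^+ 2) / 2); last by field.
by lra.
Qed.

Lemma two_point_pointwise p u v : 1 < p -> p <= 2 ->
  (u ^+ 2 + two_point_const p * v ^+ 2) `^ (p / 2) <=
  (`|u + v| `^ p + `|u - v| `^ p) / 2.
Proof.
move=> p1 p2.
have pos a b : 0 <= a -> 0 <= b ->
    (a ^+ 2 + two_point_const p * b ^+ 2) `^ (p / 2) <=
    (`|a + b| `^ p + `|a - b| `^ p) / 2.
  move=> a0 b0; have [ba|/ltW ab] := leP b a.
    by rewrite !ger0_norm ?two_point_ordered //; lra.
  rewrite ger0_norm ?addr_ge0 // ler0_norm ?subr_le0 // opprB [a + b]addrC.
  apply: le_trans (two_point_ordered p1 p2 a0 ab).
  (* As the constant is at most 1, exchanging [a] and [b] does not decrease the left side when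
     [a <= b]. *)
  have c0 := two_point_const_gt0 p1; have c1 := two_point_const_le1 p2.
  have cn s t : 0 <= s ^+ 2 + two_point_const p * t ^+ 2.
    by rewrite addr_ge0 ?sqr_ge0 // pmulr_rge0 ?sqr_ge0.
  rewrite ge0_ler_powR ?nnegrE ?cn //; first by lra.
  have : a ^+ 2 <= b ^+ 2 by rewrite ler_sqr ?nnegrE.
  rewrite -subr_ge0 => ba2; rewrite -subr_ge0.
    rewrite [leRHS](_ : _ = (1 - two_point_const p) * (b ^+ 2 - a ^+ 2)); last by ring.
  by rewrite mulr_ge0 // subr_ge0.
have := pos `|u| `|v| (normr_ge0 _) (normr_ge0 _).
rewrite !real_normK ?num_real //.
have [u0|/ltW u0] := leP 0 u; have [v0|/ltW v0] := leP 0 v.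
- by rewrite (ger0_norm u0) (ger0_norm v0).
- by rewrite (ger0_norm u0) (ler0_norm v0) opprK [X in _ <= X / _]addrC.
- rewrite (ler0_norm u0) (ger0_norm v0) -(normrN (- u + v)) -(normrN (- u - v)).
  by rewrite !opprD !opprK [X in _ <= X / _]addrC.
- rewrite (ler0_norm u0) (ler0_norm v0) -(normrN (- u + - v)) -(normrN (- u - - v)).
  by rewrite !opprD !opprK.
Qed.

(** Concavity at the points [s / a] and [t / b] with weights [a] and [b]; a vanishing weight is
    treated apart. *)
Lemma concave_weights_powR r a b s t : 0 < r -> r < 1 -> 0 <= a -> 0 <= b ->
  a + b = 1 -> 0 <= s -> 0 <= t ->
  a `^ (1 - r) * s `^ r + b `^ (1 - r) * t `^ r <= (s + t) `^ r.
Proof.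
move=> r0 r1 a0 b0 ab s0 t0.
have r1' : 1 - r != 0 by rewrite subr_eq0 eq_sym lt_eqF.
have mono x y : 0 <= x -> x <= y -> x `^ r <= y `^ r.
  by move=> x0 xy; rewrite ge0_ler_powR ?nnegrE ?(ltW r0) ?(le_trans x0 xy).
move: a0; rewrite le_eqVlt => /predU1P[ea|a0].
  have -> : b = 1 by lra.
  by rewrite -ea powR0 // mul0r add0r powR1 mul1r mono //; lra.
move: b0; rewrite le_eqVlt => /predU1P[eb|b0].
  have -> : a = 1 by lra.
  by rewrite -eb powR0 // mul0r addr0 powR1 mul1r mono //; lra.
have weight x y : 0 < x -> 0 <= y -> x `^ (1 - r) * y `^ r = x * (y / x) `^ r.
  move=> x0 y0.
  rewrite powRM ?invr_ge0 ?(ltW x0) // -powR_inv1 ?(ltW x0) // -powRrM mulN1r.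
  rewrite [RHS]mulrCA [LHS]mulrC; congr (_ * _).
  rewrite -{2}(powRr1 (ltW x0)) -powRD //.
  by rewrite (gt_eqF x0) implybT.
rewrite !weight //.
have sa : 0 <= s / a by rewrite divr_ge0 // ltW.
have tb : 0 <= t / b by rewrite divr_ge0 // ltW.
apply: le_trans (concave_combination_powR r0 (ltW r1) (ltW a0) (ltW b0) ab sa tb) _.
by rewrite (mulrC a) (mulrC b) !divfK ?gt_eqF.
Qed.

End PowerInequalities.

(** * Uniform convexity and the fork inequality in L^p *)

Lemma Lspace_Lfun d (T : measurableType d) (R : realType)
    (mu : {measure set T -> \bar R}) (p : \bar R) (p1 : (1 <= p)%E)
    (f : LspaceType mu p1) : (f : T -> R) \in Lfun mu p.
Proof.
apply/andP; split; rewrite inE /=; last exact: Lebesgue_finite.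
case: f => f fP; pose h := repr f : {mfun T >-> measurableTypeR R}.
exact: (@measurable_funPT _ _ _ _ h).
Qed.

Section LpUniformConvexity.
Context d (T : measurableType d) (R : realType).
Variables (mu : {measure set T -> \bar R}) (p : R).
Hypothesis p1 : 1 < p.
Implicit Types f g h : T -> R.

Let p0 : 0 < p. Proof. exact: lt_trans p1. Qed.

Let nm h : R := fine 'N[mu]_(p%:E)[EFin \o h]%E.

Let I h : R := \int[mu]_x (`|h x| `^ p).

Let nm_ge0 h : 0 <= nm h.
Proof. exact/fine_ge0/Lnorm_ge0. Qed.

Let nm_powR h : nm h `^ p = I h.
Proof.
by rewrite /nm -fine_poweR poweR_Lnorm // gt_eqF.
Qed.

Let LfunD f g : f \in Lfun mu p%:E -> g \in Lfun mu p%:E ->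
  (fun x => f x + g x) \in Lfun mu p%:E.
Proof.
by have [_ addL] := Lfun_addr_closed mu (lt1_lee1 p1) => fL gL; exact: addL.
Qed.

Let LfunB f g : f \in Lfun mu p%:E -> g \in Lfun mu p%:E ->
  (fun x => f x - g x) \in Lfun mu p%:E.
Proof.
move=> fL gL; apply: LfunD => //.
exact: (@Lfun_oppr_closed _ _ _ mu p%:E g).
Qed.

Let Lfun_powR h : h \in Lfun mu p%:E ->
  mu.-integrable setT (fun x => (`|h x| `^ p)%:E).
Proof. exact/Lfun_integrable/ltW. Qed.

Let I_le f1 f2 g1 g2 (a b a' b' : R) :
  [/\ f1 \in Lfun mu p%:E, f2 \in Lfun mu p%:E, g1 \in Lfun mu p%:E
    & g2 \in Lfun mu p%:E] ->
  (forall x, a * `|f1 x| `^ p + b * `|f2 x| `^ p <=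
             a' * `|g1 x| `^ p + b' * `|g2 x| `^ p) ->
  a * I f1 + b * I f2 <= a' * I g1 + b' * I g2.
Proof.
move=> [f1L f2L g1L g2L] H.
have E s t u v : u \in Lfun mu p%:E -> v \in Lfun mu p%:E ->
    (s * I u + t * I v =
      \int[mu]_x (s * `|u x| `^ p + t * `|v x| `^ p))%R /\
    mu.-integrable setT (fun x => (s * `|u x| `^ p + t * `|v x| `^ p)%:E).
  move=> uL vL; have Iu := Lfun_powR uL; have Iv := Lfun_powR vL.
  have sIu : mu.-integrable setT (fun x => (s * `|u x| `^ p)%:E).
    by under eq_fun do rewrite EFinM; exact: integrableZl.
  have tIv : mu.-integrable setT (fun x => (t * `|v x| `^ p)%:E).
    by under eq_fun do rewrite EFinM; exact: integrableZl.
  split.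
    by rewrite RintegralD // !RintegralZl.
  by under eq_fun do rewrite EFinD; exact: integrableD.
have [-> Hf] := E a b _ _ f1L f2L; have [-> Hg] := E a' b' _ _ g1L g2L.
by apply: le_Rintegral => // x _; exact: H.
Qed.

Let nmZ (a : R) f : f \in Lfun mu p%:E -> nm (fun x => a * f x) = `|a| * nm f.
Proof.
move=> fL; have := LnormZ (Lfun_Sub (lt1_lee1 p1) fL) a.
by rewrite /nm => h; rewrite [X in fine X]h fineM // -finite_norm_fine.
Qed.

Let nm_triangle f g : f \in Lfun mu p%:E -> g \in Lfun mu p%:E ->
  nm (fun x => f x - g x) <= nm f + nm g.
Proof.
move=> fL gL.
have := ler_LnormD (Lfun_Sub (lt1_lee1 p1) fL) (- Lfun_Sub (lt1_lee1 p1) gL).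
by have := LnormrN (Lfun_Sub (lt1_lee1 p1) gL) => ->.
Qed.

Lemma clarkson f g : 2 <= p -> f \in Lfun mu p%:E -> g \in Lfun mu p%:E ->
  nm f `^ p + nm g `^ p <=
  (nm (fun x => f x + g x) `^ p + nm (fun x => f x - g x) `^ p) / 2.
Proof.
move=> p2 fL gL; rewrite !nm_powR.
have := @I_le f g (fun x => f x + g x) (fun x => f x - g x) 1 1 2^-1 2^-1.
rewrite !mul1r -mulrDr mulrC; apply; first by split=> //; [exact: LfunD|exact: LfunB].
by move=> x; rewrite !mul1r -mulrDr mulrC clarkson_pointwise.
Qed.

(* Integrating the pointwise two-point inequality gives a lower bound by the
   [p/2]-"norm" of a sum, to which the reverse Minkowski inequality applies; the
   latter is obtained from concavity with the weights [a] and [b]. *)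
Lemma two_point_norm f g : p < 2 -> f \in Lfun mu p%:E -> g \in Lfun mu p%:E ->
  nm f ^+ 2 + two_point_const p * nm g ^+ 2 <=
  (nm (fun x => f x + g x) ^+ 2 + nm (fun x => f x - g x) ^+ 2) / 2.
Proof.
move=> p2 fL gL; set c := two_point_const p.
have c0 : 0 < c := two_point_const_gt0 p1.
set A := nm f ^+ 2; set B := c * nm g ^+ 2.
set X := nm (fun x => f x + g x) ^+ 2; set Y := nm (fun x => f x - g x) ^+ 2.
have A0 : 0 <= A by exact: sqr_ge0.
have B0 : 0 <= B by rewrite pmulr_rge0 ?sqr_ge0.
have X0 : 0 <= X by exact: sqr_ge0.
have Y0 : 0 <= Y by exact: sqr_ge0.
have : 0 <= A + B by exact: addr_ge0.
rewrite le_eqVlt => /predU1P[<-|S0]; first by rewrite divr_ge0 ?addr_ge0.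
set r := p / 2; have r0 : 0 < r by rewrite divr_gt0.
have r1 : r < 1 by rewrite ltr_pdivrMr // mul1r.
(* Weights proportional to [A] and [B] turn the weighted sum of r-th powers into exactly the r-th
   power of [A + B]. *)
set a := A / (A + B); set b := B / (A + B).
have a0 : 0 <= a by rewrite divr_ge0 // ltW.
have b0 : 0 <= b by rewrite divr_ge0 // ltW.
have ab : a + b = 1 by rewrite /a /b -mulrDl mulfV // gt_eqF.
have sqr_r w : 0 <= w -> (w ^+ 2) `^ r = w `^ p by exact: sqr_powR_half.
have If : I f = A `^ r by rewrite -nm_powR sqr_r.
have Ig : c `^ r * I g = B `^ r.
  by rewrite -nm_powR /B powRM ?(ltW c0) ?sqr_ge0 // sqr_r.
have IX : I (fun x => f x + g x) = X `^ r by rewrite -nm_powR sqr_r.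
have IY : I (fun x => f x - g x) = Y `^ r by rewrite -nm_powR sqr_r.
have split_weight w : 0 <= w -> (w / (A + B)) `^ (1 - r) * w `^ r =
    w / (A + B) * (A + B) `^ r.
  move=> w0; have wS : 0 <= w / (A + B) by rewrite divr_ge0 // ltW.
  rewrite -{2}(divfK (lt0r_neq0 S0) w) (powRM _ wS (ltW S0)) mulrA.
  by rewrite -powRD ?subrK ?powRr1 // oner_eq0.
have le_r : (A + B) `^ r <= ((X + Y) / 2) `^ r.
  have := @I_le f g (fun x => f x + g x) (fun x => f x - g x)
    (a `^ (1 - r)) (b `^ (1 - r) * c `^ r) 2^-1 2^-1.
  rewrite -(mulrA _ _ (I g)) Ig If !split_weight // -mulrDl -/a -/b ab mul1r => H.
  apply: le_trans (H _ _) _.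
  - by split=> //; [exact: LfunD|exact: LfunB].
  - move=> x; rewrite -mulrDr (mulrC _^-1).
    apply: le_trans (two_point_pointwise (f x) (g x) p1 (ltW p2)).
    have cg0 : 0 <= c * g x ^+ 2 by rewrite pmulr_rge0 ?sqr_ge0.
    apply: le_trans (concave_weights_powR r0 r1 a0 b0 ab (sqr_ge0 (f x)) cg0).
    rewrite powRM ?(ltW c0) ?sqr_ge0 // -mulrA.
    rewrite -(@real_normK _ (f x)) ?num_real // -(@real_normK _ (g x)) ?num_real //.
    by rewrite !sqr_r.
  - rewrite IX IY (mulrDl X Y) (mulrC X) (mulrC Y).
    by apply: concave_combination_powR => //; rewrite ?(ltW r1) //; lra.
rewrite leNgt; apply/negP => lt.
have := @gt0_ltr_powR R _ r0 ((X + Y) / 2) (A + B).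
rewrite !nnegrE => /(_ _ _ lt); rewrite ltNge le_r => H.
by suff: false by []; apply: H; rewrite ?divr_ge0 ?addr_ge0 // ltW.
Qed.

(** The two norm inequalities are applied to f + g and f - g, whose sum and difference are 2f and
    2g. *)
Lemma Lp_uniform_convexity : exists2 c : R, 0 < c &
  forall f g, f \in Lfun mu p%:E -> g \in Lfun mu p%:E ->
  let q := Num.max p 2 in
  nm (fun x => f x + g x) `^ q + c * nm (fun x => f x - g x) `^ q <=
  2 `^ q * ((nm f `^ q + nm g `^ q) / 2).
Proof.
have double f : f \in Lfun mu p%:E -> nm (fun x => 2 * f x) = 2 * nm f.
  by move=> fL; rewrite nmZ // ger0_norm.
have eD f g : (fun x => f x + g x + (f x - g x)) = (fun x => 2 * f x).
  by apply/funext => x; ring.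
have eB f g : (fun x => f x + g x - (f x - g x)) = (fun x => 2 * g x).
  by apply/funext => x; ring.
have [p2|p2] := leP 2 p.
  exists 1 => // f g fL gL /=; rewrite mul1r.
  apply: le_trans (clarkson p2 (LfunD fL gL) (LfunB fL gL)) _.
  by rewrite eD eB !double // !powRM // -mulrDr mulrA.
exists (two_point_const p); first exact: two_point_const_gt0.
move=> f g fL gL /=; rewrite !powR_mulrn //.
apply: le_trans (two_point_norm p2 (LfunD fL gL) (LfunB fL gL)) _.
by rewrite eD eB !double // !exprMn -mulrDr mulrA.
Qed.

(** Write x0 - w = (x0 - x1) + (x1 - w). The vectors (x0 - x1) - (x1 - w) for w = y and w = z differ
    by y - z, so one of them has norm at least |y - z| / 2, and uniform convexity yields the gain
    for that w. *)
Lemma Lp_fork : exists2 c : R, 0 < c &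
  forall x0 x1 y z : LspaceType mu (lt1_lee1 p1), forall B : R,
  let q := Num.max p 2 in
  let E v w := @Lp_dist d T R mu p (lt1_lee1 p1) v w `^ q in
  E x0 x1 <= B -> E x1 y <= B -> E x1 z <= B ->
  E x0 y <= 2 `^ q * B - c * E y z \/ E x0 z <= 2 `^ q * B - c * E y z.
Proof.
have [c c0 convex] := Lp_uniform_convexity.
set q := Num.max p 2; have q0 : 0 < q by rewrite lt_max p0.
have q2 : 0 < (2 : R) `^ q by exact: powR_gt0.
(* The denominator is due to the half in |y - z| / 2. *)
exists (c / 2 `^ q); first exact: divr_gt0.
move=> x0 x1 y z B /=.
have L (f g : LspaceType mu (lt1_lee1 p1)) :
    (fun x => f x - g x) \in Lfun mu p%:E.
  by apply: LfunB; exact: Lspace_Lfun.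
have side w : Lp_dist x0 x1 `^ q <= B -> Lp_dist x1 w `^ q <= B ->
    Lp_dist y z / 2 <= nm (fun x => (x0 x - x1 x) - (x1 x - w x)) ->
    Lp_dist x0 w `^ q <= 2 `^ q * B - c / 2 `^ q * Lp_dist y z `^ q.
  move=> h1 h2 h3; have := convex _ _ (L x0 x1) (L x1 w).
  have -> : (fun x => x0 x - x1 x + (x1 x - w x)) = (fun x => x0 x - w x).
    by apply/funext => x; ring.
  rewrite -/q => h; rewrite lerBrDr; apply: le_trans (le_trans h _); last first.
    by rewrite ler_pM2l //; rewrite /nm in h1 h2 *; lra.
  rewrite lerD2l -mulrA ler_pM2l // mulrC ler_pdivrMr // -powRM //.
  have yz0 : 0 <= Lp_dist y z by exact: nm_ge0.
  rewrite ge0_ler_powR ?nnegrE ?(ltW q0) ?mulr_ge0 //.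
  by rewrite -ler_pdivrMr.
move=> h1 hy hz.
have [hl|hl] := leP (Lp_dist y z / 2) (nm (fun x => (x0 x - x1 x) - (x1 x - y x))).
  by left; exact: side.
right; apply: side => //.
have := nm_triangle (LfunB (L x0 x1) (L x1 y)) (LfunB (L x0 x1) (L x1 z)).
have -> : (fun x => x0 x - x1 x - (x1 x - y x) - (x0 x - x1 x - (x1 x - z x))) =
  (fun x => y x - z x) by apply/funext => x; ring.
rewrite -[X in X <= _]/(Lp_dist y z); lra.
Qed.

End LpUniformConvexity.

(** * Large distances in the tree, uniform embeddings and compression *)

Lemma tree_far_points (R : realType) (V : eqType) (adj : rel V) (n : nat) :
  regular_tree 3 adj -> exists x y : V, path_metric R adj x y = (2 * 2 ^ n)%:R.
Proof.
(* Were scale [n] absent from the tree, [fork_sum_le] would hold for [E = 0] with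
   an arbitrary [e n], hence bound 1 by 0. *)
move=> Vtree; apply: contrapT => far.
have forks t u := regular_tree_forks t u Vtree.
have [[v] adj_sym adj_irr _ adj_acyclic _] := Vtree.
have [y [_ [vy _ _ _ _]]] := forks v v.
pose e k : R := (k == n)%:R.
have h := @fork_sum_le _ _ adj_sym adj_irr adj_acyclic forks R (fun _ _ => 0)
  1 1 0 e ltr01 ltr01.
have := h _ _ _ _ _ n.+1; rewrite mul0r => /(_ _ _ _ _ _)/wrap[]//.
- move=> k x z; rewrite /e; have [->|//] := eqVneq k n.
  by move=> xz; case: far; exists x, z.
- by move=> ? ? ? ? B B0 _ _; left; rewrite mul1r mulr0 subr0.
- by exists v, y.
rewrite big_ord_recr /= big1; last first.
  by move=> i _; rewrite /e (ltn_eqF (ltn_ord i)) mul0r.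
by rewrite add0r /e eqxx expr1n divr1 ler10.
Qed.

(** Otherwise there are pairs at distance at most [r] whose images diverge, and a uniform embedding
    would make the distances of these pairs diverge too. *)
Lemma uniform_embedding_bounded (R : realType) (X Y : Type)
    (dX : X -> X -> R) (dY : Y -> Y -> R) (F : X -> Y) (r : R) :
  uniform_embedding dX dY F ->
  exists M : R, forall x y, dX x y <= r -> dY (F x) (F y) <= M.
Proof.
move=> FE; apply: contrapT => unbounded.
have /choice[z Hz] : forall n : nat, exists z : X * X,
    dX z.1 z.2 <= r /\ n%:R < dY (F z.1) (F z.2).
  move=> n; apply: contrapT => none; apply: unbounded; exists n%:R => x y xy.
  by rewrite leNgt; apply/negP => lt; apply: none; exists (x, y).
have [_ /(_ _)/wrap[]] := FE (fun n => (z n).1) (fun n => (z n).2).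
  apply/cvgryPge => A; near=> n.
  apply: le_trans (ltW (Hz n).2).
  near: n; exact: nbhs_infty_ger.
move=> /cvgryPgt /(_ r) [n _ /(_ n (leqnn n))] /=.
by rewrite ltNge (Hz n).1.
Unshelve. all: by end_near. Qed.

Section Compression.
Variables (R : realType) (X Y : Type).
Variables (dX : X -> X -> R) (dY : Y -> Y -> R) (F : X -> Y).
Hypothesis dY_ge0 : forall x y, 0 <= dY x y.

Lemma compression_ge0 t : (0 <= compression dX dY F t)%E.
Proof. by apply: le_ereal_inf_tmp => _ [z _ <-]; rewrite lee_fin. Qed.

Lemma compression_le x y t : t <= dX x y ->
  (compression dX dY F t <= (dY (F x) (F y))%:E)%E.
Proof. by move=> txy; apply: ereal_inf_lbound; exists (x, y). Qed.

Lemma compression_homo s t : s <= t ->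
  (compression dX dY F s <= compression dX dY F t)%E.
Proof.
move=> st; apply: ereal_inf_le_tmp => _ [z tz <-].
by exists z => //=; exact: le_trans tz.
Qed.

End Compression.

(** * Comparison of the integral with a dyadic sum *)

(** On [2^k, 2^(k+1)) monotonicity bounds f by its value at the right end, 1/t is at most 2^-k, and
    the length 2^k cancels the last factor 1/t. *)
Lemma dyadic_integral_lty (R : realType) (q : R) (f : R -> R) (S : R) :
  0 < q -> (forall t, 0 <= f t) -> {homo f : s t / s <= t} ->
  (forall n, \sum_(k < n) (f (2 ^+ k.+1) / 2 ^+ k) `^ q <= S) ->
  (\int[@lebesgue_measure R]_(t in `[1%R, +oo[)
     ((f t / t) `^ q / t)%:E < +oo)%E.
Proof.
move=> q0 f0 f_homo fS.
pose A k : set R := [set` `[2 ^+ k, 2 ^+ k.+1[].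
pose D : set R := [set` `[1%R, +oo[].
have two0 k : 0 < 2 ^+ k :> R by rewrite exprn_gt0.
have cover : D = \bigcup_k A k.
  apply/seteqP; split => t; rewrite /D /= in_itv /= ?andbT.
    move=> t1; have t0 : 0 <= t by apply: le_trans t1.
    have /andP[l u] := truncn_itv t0.
    have n0 : (0 < Num.truncn t)%N by rewrite truncn_gt0.
    have /andP[l' u'] := trunc_log_bounds (isT : 1 < 2)%N n0.
    exists (trunc_log 2 (Num.truncn t)) => //; rewrite /A /= in_itv /=.
    rewrite -!natrX (le_trans _ l) ?ler_nat //= (lt_le_trans u) //.
    by rewrite ler_nat.
  move=> [k _]; rewrite /A /= in_itv /= => /andP[+ _]; apply: le_trans.
  by rewrite exprn_ege1 // ler1n.
have mf : measurable_fun D (fun t => (f t / t) `^ q / t).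
  have minv : measurable_fun D (fun t : R => t^-1).
    apply: (@eq_measurable_fun _ _ _ _ D (@powR R ^~ (-1))).
      move=> t; rewrite inE /D /= in_itv /= andbT => t1.
      by rewrite powR_inv1 // (le_trans ler01).
    by apply: measurable_funS (measurable_powR (-1)).
  apply: measurable_funM => //.
  apply: (measurableT_comp (measurable_powR q)).
  apply: measurable_funM => //.
  by apply: nondecreasing_measurable; [exact: measurable_itv | exact: f_homo].
have g0 t : D t -> (0 <= ((f t / t) `^ q / t)%:E)%E.
  rewrite /D /= in_itv /= andbT => t1; rewrite lee_fin divr_ge0 ?powR_ge0 //.
  exact: le_trans t1.
have mA k : measurable (A k) by exact: measurable_itv.
rewrite -/D cover ge0_integral_bigcup //.
- have le k : (\int[@lebesgue_measure R]_(t in A k) ((f t / t) `^ q / t)%:E <=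
      ((f (2 ^+ k.+1) / 2 ^+ k) `^ q)%:E)%E.
    pose c := (f (2 ^+ k.+1) / 2 ^+ k) `^ q / 2 ^+ k.
    have AD : A k `<=` D by rewrite cover; exact: bigcup_sup.
    apply: (@le_trans _ _ (\int[@lebesgue_measure R]_(t in A k) cst c%:E t)%E).
      apply: ge0_le_integral => //.
      + exact: measurable_itv.
      + by move=> t At; apply: g0; exact: AD.
      + apply/measurable_EFinP; apply: measurable_funS mf => //.
        exact: measurable_itv.
      + move=> t; rewrite /A /= in_itv /= => /andP[kt tk].
        have t0 : 0 < t by exact: lt_le_trans kt.
        have inv_le : t^-1 <= (2 ^+ k)^-1 by rewrite lef_pV2 ?posrE.
        rewrite lee_fin /c ler_pM ?powR_ge0 ?invr_ge0 ?(ltW t0) //.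
        rewrite ge0_ler_powR ?nnegrE ?divr_ge0 ?(ltW q0) ?(ltW t0) ?(ltW (two0 k)) //.
        by rewrite ler_pM ?invr_ge0 ?(ltW t0) // f_homo // ltW.
    rewrite integral_cst; last exact: measurable_itv.
    have muA : (@lebesgue_measure R (A k) <= (2 ^+ k)%:E)%E.
      rewrite (lebesgue_measure_itv `[2 ^+ k, 2 ^+ k.+1[) /= lte_fin.
      rewrite ltr_eXn2l ?ltr1n // ltnSn -EFinB exprS lee_fin.
      by rewrite le_eqVlt; apply/orP; left; apply/eqP; ring.
    apply: (@le_trans _ _ (c%:E * (2 ^+ k)%:E)%E).
      by apply: lee_pmul; rewrite ?measure_ge0 // lee_fin divr_ge0 ?powR_ge0 ?ltW.
    by rewrite -EFinM lee_fin /c divfK // gt_eqF.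
  apply: (@le_lt_trans _ _ S%:E); last exact: ltry.
  apply: lime_le.
    apply: is_cvg_nneseries => n _ _; apply: integral_ge0 => t At.
    by apply: g0; rewrite cover; exists n.
  apply: nearW => n; apply: (@le_trans _ _
    (\sum_(0 <= k < n) ((f (2 ^+ k.+1) / 2 ^+ k) `^ q)%:E)%E).
    by apply: lee_sum => k _; exact: le.
  by rewrite sumEFin lee_fin big_mkord.
- by rewrite -cover; apply/measurable_EFinP.
- by rewrite -cover.
- move=> i j _ _ [t []]; rewrite /A /= !in_itv /= => /andP[a b] /andP[a' b'].
  have := le_lt_trans a b'; have := le_lt_trans a' b.
  by rewrite !ltr_eXn2l ?ltr1n // !ltnS => ji ij; apply/eqP; rewrite eqn_leq ij.
Qed.

(** * Transfer of the dyadic bound from the tree to the compression *)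

Theorem corollary5 (R : realType) (V : eqType) (adj : rel V) (X : metricType R)
    (Vtree : regular_tree 3 adj)
    (VX : quasi_isometrically_embeds (@path_metric R V adj) (@mdist R X))
    (p : R) (p1 : 1 < p)
    (d : measure_display) (T : measurableType d) (mu : {measure set T -> \bar R})
    (F : X -> LspaceType mu (lt1_lee1 p1))
    (FE : uniform_embedding (@mdist R X) (@Lp_dist d T R mu p (lt1_lee1 p1)) F) :
  let q := Num.max p 2 in
  let rho := compression (@mdist R X) (@Lp_dist d T R mu p (lt1_lee1 p1)) F in
  (\int[@lebesgue_measure R]_(t in `[1%R, +oo[)
     ((rho t * (t^-1)%:E) `^ q * (t^-1)%:E) < +oo)%E.
Proof.
cbv zeta; set q := Num.max p 2; set rho := compression _ _ _.
have q0 : 0 < q by rewrite lt_max (lt_trans ltr01 p1).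
have [g [L [C [L1 C0 gLC]]]] := VX.
(* Adjacent vertices have images in [X] at distance at most [L + C], so [M] bounds the composed map
   on edges. *)
have [M FM] := uniform_embedding_bounded (L + C) FE.
have [c c0 fork] := Lp_fork mu p1.
have dist0 (x y : LspaceType mu (lt1_lee1 p1)) : 0 <= Lp_dist x y.
  exact/fine_ge0/Lnorm_ge0.
have [[v] adj_sym adj_irr _ adj_acyclic _] := Vtree.
have forks t u := regular_tree_forks t u Vtree.
set K : R := 2 `^ q; have K0 : 0 < K by exact: powR_gt0.
(* Enough dyadic scales are given up to absorb [L] and [C]. *)
have [s sLC] : exists s, L * (1 + C) <= 2 ^+ s.
  exists (Num.truncn (L * (1 + C))).+1; apply/ltW/(lt_le_trans (truncnS_gt _)).
  by rewrite -natrX ler_nat ltnW // ltn_expl.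
have far k x y : path_metric R adj x y = (2 * 2 ^ (s.+1 + k))%:R ->
    2 ^+ k.+1 <= mdist (g x) (g y).
  move=> xy; have /andP[+ _] := gLC x y; apply: le_trans.
  have k1 : 1 <= 2 ^+ k.+1 :> R by rewrite exprn_ege1 // ler1n.
  have -> : path_metric R adj x y = 2 ^+ s * (2 * 2 ^+ k.+1).
    by rewrite xy natrM natrX addSnnS exprD; ring.
  have : 1 + C <= L^-1 * 2 ^+ s by rewrite ler_pdivlMl // (lt_le_trans ltr01).
  move=> /(@ler_wpM2r _ (2 * 2 ^+ k.+1)) -/(_ _)/wrap[|]; first by lra.
  rewrite -mulrA; have := ler_wpM2l C0 k1; lra.
have rho_ge0 t : (0 <= rho t)%E by exact: compression_ge0.
(* Arbitrarily distant tree points keep the infimum from ranging over the empty set. *)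
have rho_lty t : (rho t < +oo)%E.
  pose n := (Num.truncn t).+1.
  have [x [y xy]] := tree_far_points R (s.+1 + n) Vtree.
  apply: le_lt_trans (ltry (Lp_dist (F (g x)) (F (g y)))).
  apply: compression_le; apply: le_trans (far _ _ _ xy).
  apply/ltW/(lt_le_trans (truncnS_gt _)); rewrite -natrX ler_nat.
  by rewrite (leq_trans (ltnW (ltn_expl n (isT : 1 < 2)%N))) // leq_exp2l.
pose r t := fine (rho t).
have rE t : rho t = (r t)%:E by rewrite fineK // ge0_fin_numE.
have r0 t : 0 <= r t by exact: fine_ge0.
have : (\int[@lebesgue_measure R]_(t in `[1%R, +oo[)
     ((r t / t) `^ q / t)%:E < +oo)%E.
  (* The power of [K] undoes the shift by [s.+1] scales and the extra factor in [K ^+ k.+1]. *)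
  apply: (@dyadic_integral_lty _ _ _ (K ^+ s.+2 * (M `^ q / c))) => //.
    by move=> t u tu; rewrite -lee_fin -!rE compression_homo.
  move=> n.
  (* At the first [s.+1] scales, where [far] says nothing, the trivial bound 0 is used. *)
  pose e k : R := if (k < s.+1)%N then 0 else r (2 ^+ (k - s.+1).+1) `^ q.
  have := @fork_sum_le _ _ adj_sym adj_irr adj_acyclic forks R
    (fun x y => Lp_dist (F (g x)) (F (g y)) `^ q) K c (M `^ q) e K0 c0.
  move=> /(_ _ _ _ _ _ (s.+1 + n)%N)/wrap[].
  - by move=> x y; exact: powR_ge0.
  - move=> x y xy; have le_M : Lp_dist (F (g x)) (F (g y)) <= M.
      apply: FM; have /andP[_] := gLC x y.
      by rewrite (path_metric_adj adj_sym adj_irr adj_acyclic R xy) mulr1.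
    by rewrite ge0_ler_powR ?nnegrE ?(ltW q0) // (le_trans _ le_M).
  - move=> k x y xy; rewrite /e; case: ltnP => [_|sk]; first exact: powR_ge0.
    rewrite ge0_ler_powR ?nnegrE ?(ltW q0) // -lee_fin -rE.
    by apply: compression_le; apply: far; rewrite subnKC.
  - by move=> x0 x1 y z B; exact: fork.
  - by have [y [_ [vy _ _ _ _]]] := forks v v; exists v, y.
  rewrite big_split_ord /= big1 ?add0r; last first.
    by move=> i _; rewrite /e ltn_ord mul0r.
  rewrite -(ler_pM2l (exprn_gt0 s.+2 K0)); apply: le_trans.
  rewrite mulr_sumr; apply: ler_sum => k _.
  rewrite /e ltnNge leq_addr /= addKn.
  rewrite powRM ?invr_ge0 ?exprn_ge0 //.
  have -> : (2 ^- k) `^ q = K ^- k :> R.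
    by rewrite -(@powR_invn R 2) // powRAC powR_invn // ltW.
  rewrite -addSn exprD.
  rewrite le_eqVlt; apply/orP; left; apply/eqP.
  by field; rewrite !expf_neq0 // gt_eqF.
apply: le_lt_trans; rewrite le_eqVlt; apply/orP; left; apply/eqP.
by apply: eq_integral => t _; rewrite rE -(EFinM (r t)) poweR_EFin -EFinM.
Qed.
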